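(* Let $P(q)=\sum_{j=0}^{n} q^{j}a_{j}$ be a slice regular polynomial of degree $n$ with quaternionic coefficients $a_j\in\mathbb H$, and let $P'(q)=\sum_{j=1}^{n} q^{j-1}ja_{j}$. Then $$\|P'\|\leq n\|P\|,$$ where $\|F\|=\max_{|q|\leq 1}|F(q)|$. Moreover, equality holds if and only if $P(q)=q^{n}a_{n}$ for some $a_{n}\in\mathbb H$.
   Context: $\mathbb H$ denotes the real algebra of quaternions with basis $1,i,j,k$, $i^2=j^2=k^2=ijk=-1$, and modulus $|q|=\sqrt{q\bar q}$. A slice regular polynomial is a function $\mathbb H\to\mathbb H$ of the form $q\mapsto\sum_{j=0}^n q^j a_j$ with coefficients written on the right; it has degree $n$ if $a_n\neq 0$. Its derivative is $P'(q)=\sum_{j=1}^n q^{j-1}ja_j$. *)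

(* Defs.v *)
From HB Require Import structures.
From mathcomp Require Import all_boot all_order all_algebra.
From mathcomp Require Import classical_sets reals.
Set Implicit Arguments. Unset Strict Implicit. Unset Printing Implicit Defensive.
Import Order.TTheory GRing.Theory Num.Theory.
Local Open Scope ring_scope.
Local Open Scope classical_set_scope.

Section Quat.
Variable R : realType.

Record quat := Quat { qre : R; qi : R; qj : R; qk : R }.

Definition qzero : quat := Quat 0 0 0 0.
Definition qone : quat := Quat 1 0 0 0.
Definition qadd (p q : quat) : quat :=
  Quat (qre p + qre q) (qi p + qi q) (qj p + qj q) (qk p + qk q).
(* Hamilton product, i^2 = j^2 = k^2 = ijk = -1 *)
Definition qmul (p q : quat) : quat :=
  Quat (qre p * qre q - qi p * qi q - qj p * qj q - qk p * qk q)
       (qre p * qi q + qi p * qre q + qj p * qk q - qk p * qj q)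
       (qre p * qj q - qi p * qk q + qj p * qre q + qk p * qi q)
       (qre p * qk q + qi p * qj q - qj p * qi q + qk p * qre q).
Definition qscale (c : R) (q : quat) : quat :=
  Quat (c * qre q) (c * qi q) (c * qj q) (c * qk q).
Definition qnorm (q : quat) : R :=
  Num.sqrt (qre q ^+ 2 + qi q ^+ 2 + qj q ^+ 2 + qk q ^+ 2).
Fixpoint qpow (q : quat) (n : nat) : quat :=
  match n with O => qone | S m => qmul (qpow q m) q end.
Fixpoint qsum (f : nat -> quat) (n : nat) : quat :=
  match n with O => f O | S m => qadd (qsum f m) (f n) end.

Definition spoly (a : nat -> quat) (n : nat) (q : quat) : quat :=
  qsum (fun j => qmul (qpow q j) (a j)) n.
Definition spoly_deriv (a : nat -> quat) (n : nat) (q : quat) : quat :=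
  match n with
  | O => qzero
  | S m => qsum (fun i => qmul (qpow q i) (qscale (i.+1)%:R (a i.+1))) m
  end.

(* ||F|| = max_{|q| <= 1} |F(q)| (the max exists; we use the supremum) *)
Definition supnorm (F : quat -> quat) : R :=
  sup [set qnorm (F q) | q in [set q : quat | qnorm q <= 1]].
End Quat.

(* Main.v *)
(* Let u be a unit quaternion, z a primitive N-th root of unity in the slice of
   u, where N = 2n + 1, and w_l = |sum_(p < n) z^(lp)|^2 the values of the Fejer
   kernel. Since the points u z^l all commute, comparing coefficients gives
     sum_l w_l z^(-ln) P(u z^l) = N u P'(u),   sum_l w_l = N n.
   So u P'(u) / n is a weighted mean of points of modulus at most ||P||, whence
   |P'(u)| <= n ||P||. As N and n are coprime, all the w_l are positive; in case
   of equality strict convexity then makes z^(-ln) P(u z^l) independent of l, and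
   discrete Fourier inversion kills every coefficient of P but the leading one.
   The maximum of |P'| on the closed ball is attained on the unit sphere. *)
Require Import Defs.
From HB Require Import structures.
From mathcomp Require Import all_boot all_order all_algebra.
From mathcomp Require Import classical_sets reals.
From mathcomp Require Import boolp topology normedtype derive trigo.
From mathcomp Require Import ring lra zify.
Import Order.TTheory GRing.Theory Num.Theory numFieldNormedType.Exports.
Local Open Scope ring_scope.

(** * Quaternions as a real associative algebra *)

Section Algebra.
Local Set Implicit Arguments. Local Unset Strict Implicit.
Variable R : realType.
Implicit Types (p q u v x y z : quat R) (c : R).

Lemma quat_eq p q : qre p = qre q -> qi p = qi q -> qj p = qj q ->
  qk p = qk q -> p = q.
Proof. by case: p q => [? ? ? ?] [? ? ? ?] /= -> -> -> ->. Qed.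

(** Bijection with [R^4]: it transports the choice structure here, and its inverse later makes the
    unit ball a compact subset of [R^4]. *)
Definition tuple_of_quat q := (qre q, qi q, qj q, qk q).
Definition quat_of_tuple (t : R * R * R * R) :=
  let: (x, y, z, w) := t in Quat x y z w.

Lemma tuple_of_quatK : cancel tuple_of_quat quat_of_tuple.
Proof. by case. Qed.

HB.instance Definition _ := Choice.copy (quat R) (can_type tuple_of_quatK).

Definition qopp q := Quat (- qre q) (- qi q) (- qj q) (- qk q).

Fact qaddA : associative (@qadd R).
Proof. by move=> p q v; apply: quat_eq; rewrite /= addrA. Qed.
Fact qaddC : commutative (@qadd R).
Proof. by move=> p q; apply: quat_eq; rewrite /= addrC. Qed.
Fact qadd0 : left_id (qzero R) (@qadd R).
Proof. by move=> p; apply: quat_eq; rewrite /= add0r. Qed.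
Fact qaddN : left_inverse (qzero R) qopp (@qadd R).
Proof. by move=> p; apply: quat_eq; rewrite /= addNr. Qed.

HB.instance Definition _ := GRing.isZmodule.Build (quat R) qaddA qaddC qadd0 qaddN.

Fact qmulA : associative (@qmul R).
Proof. by move=> p q v; apply: quat_eq => /=; ring. Qed.
Fact qmul1l : left_id (qone R) (@qmul R).
Proof. by move=> p; apply: quat_eq => /=; ring. Qed.
Fact qmul1r : right_id (qone R) (@qmul R).
Proof. by move=> p; apply: quat_eq => /=; ring. Qed.
Fact qmulDl : left_distributive (@qmul R) +%R.
Proof. by move=> p q v; apply: quat_eq => /=; ring. Qed.
Fact qmulDr : right_distributive (@qmul R) +%R.
Proof. by move=> p q v; apply: quat_eq => /=; ring. Qed.
Fact qone_neq0 : qone R != 0.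
Proof. by apply/eqP => -[/eqP]; rewrite oner_eq0. Qed.

HB.instance Definition _ := GRing.Zmodule_isNzRing.Build (quat R)
  qmulA qmul1l qmul1r qmulDl qmulDr qone_neq0.

Fact qscaleA c d q : qscale c (qscale d q) = qscale (c * d) q.
Proof. by apply: quat_eq => /=; ring. Qed.
Fact qscale1 : left_id 1 (@qscale R).
Proof. by move=> p; apply: quat_eq => /=; ring. Qed.
Fact qscaleDr : right_distributive (@qscale R) +%R.
Proof. by move=> c p q; apply: quat_eq => /=; ring. Qed.
Fact qscaleDl q : {morph (@qscale R)^~ q : c d / c + d}.
Proof. by move=> c d; apply: quat_eq => /=; ring. Qed.

HB.instance Definition _ := GRing.Zmodule_isLmodule.Build R (quat R)
  qscaleA qscale1 qscaleDr qscaleDl.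

Fact qscaleAl c p q : c *: (p * q) = c *: p * q.
Proof. by apply: quat_eq => /=; ring. Qed.
HB.instance Definition _ := GRing.Lmodule_isLalgebra.Build R (quat R) qscaleAl.
Fact qscaleAr c p q : c *: (p * q) = p * (c *: q).
Proof. by apply: quat_eq => /=; ring. Qed.
HB.instance Definition _ := GRing.Lalgebra_isAlgebra.Build R (quat R) qscaleAr.

Lemma qpowE q n : qpow q n = q ^+ n.
Proof. by elim: n => [|n IH] //=; rewrite exprSr IH. Qed.

Lemma qsumE (f : nat -> quat R) n : qsum f n = \sum_(j < n.+1) f j.
Proof.
by elim: n => [|n IH] /=; rewrite big_ord_recr /= ?IH // big_ord0 add0r.
Qed.

Lemma spolyE (a : nat -> quat R) n q : spoly a n q = \sum_(j < n.+1) q ^+ j * a j.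
Proof. by rewrite /spoly qsumE; apply: eq_bigr => j _; rewrite qpowE. Qed.

Lemma spoly_derivE (a : nat -> quat R) n :
  spoly_deriv a n.+1 = spoly (fun i => i.+1%:R *: a i.+1) n.
Proof. by []. Qed.

Fact qre_additive : zmod_morphism (@qre R). Proof. by []. Qed.
Fact qi_additive : zmod_morphism (@qi R). Proof. by []. Qed.
Fact qj_additive : zmod_morphism (@qj R). Proof. by []. Qed.
Fact qk_additive : zmod_morphism (@qk R). Proof. by []. Qed.
HB.instance Definition _ := GRing.isZmodMorphism.Build (quat R) R (@qre R) qre_additive.
HB.instance Definition _ := GRing.isZmodMorphism.Build (quat R) R (@qi R) qi_additive.
HB.instance Definition _ := GRing.isZmodMorphism.Build (quat R) R (@qj R) qj_additive.
HB.instance Definition _ := GRing.isZmodMorphism.Build (quat R) R (@qk R) qk_additive.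

(** * Squared modulus, conjugation and weighted means *)

Definition qnormsq q := qre q ^+ 2 + qi q ^+ 2 + qj q ^+ 2 + qk q ^+ 2.

Lemma qnormsq_ge0 q : 0 <= qnormsq q.
Proof. by rewrite !addr_ge0 ?sqr_ge0. Qed.

Lemma qnormsq_eq0 q : (qnormsq q == 0) = (q == 0).
Proof.
apply/eqP/eqP => [|->]; last by rewrite /qnormsq /= expr0n /= !addr0.
rewrite /qnormsq => h.
have f (x : R) : x ^+ 2 <= 0 -> x = 0.
  by move=> hx; apply/eqP; rewrite -sqrf_eq0 eq_le hx sqr_ge0.
have := (sqr_ge0 (qre q), sqr_ge0 (qi q), sqr_ge0 (qj q), sqr_ge0 (qk q)).
by move=> [[[? ?] ?] ?]; apply: quat_eq; apply: f; lra.
Qed.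

(** Euler's four-square identity, a polynomial identity in the coordinates. *)
Lemma qnormsqM p q : qnormsq (p * q) = qnormsq p * qnormsq q.
Proof. by rewrite /qnormsq /=; ring. Qed.

Lemma qnormsqZ c q : qnormsq (c *: q) = c ^+ 2 * qnormsq q.
Proof. by rewrite /qnormsq /=; ring. Qed.

Lemma qnormsq1 : qnormsq 1 = 1.
Proof. by rewrite /qnormsq /=; ring. Qed.

Lemma qnormsqX q n : qnormsq (q ^+ n) = qnormsq q ^+ n.
Proof. by elim: n => [|n IH]; rewrite ?expr0 ?qnormsq1 // !exprS qnormsqM IH. Qed.

Lemma qmul_eq0 p q : (p * q == 0) = (p == 0) || (q == 0).
Proof. by rewrite -!qnormsq_eq0 qnormsqM mulf_eq0. Qed.

Lemma qmul_inj p : p != 0 -> injective ( *%R p).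
Proof.
move=> p0 x y /eqP; rewrite -subr_eq0 -mulrBr qmul_eq0 (negPf p0) /=.
by rewrite subr_eq0 => /eqP.
Qed.

Lemma qnormE q : qnorm q = Num.sqrt (qnormsq q).
Proof. by []. Qed.

Lemma qnorm_le1 q : (qnorm q <= 1) = (qnormsq q <= 1).
Proof. by rewrite qnormE -{1}sqrtr1 ler_sqrt. Qed.

Definition qconj q := Quat (qre q) (- qi q) (- qj q) (- qk q).
Fact qconj_additive : zmod_morphism qconj.
Proof. by move=> p q; apply: quat_eq => //=; ring. Qed.
HB.instance Definition _ :=
  GRing.isZmodMorphism.Build (quat R) (quat R) qconj qconj_additive.

Lemma qconjM p q : qconj (p * q) = qconj q * qconj p.
Proof. by apply: quat_eq => /=; ring. Qed.

Lemma qconjX q n : qconj (q ^+ n) = qconj q ^+ n.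
Proof.
elim: n => [|n IH]; first by apply: quat_eq => /=; ring.
by rewrite exprS exprSr qconjM IH.
Qed.

Lemma mul_qconj q : q * qconj q = (qnormsq q)%:A.
Proof. by apply: quat_eq; rewrite /qnormsq /=; ring. Qed.

(* Gives at once [qnormsq V <= max_l (qnormsq (v l))] and its equality case. *)
Lemma weighted_variance {N} (w : 'I_N -> R) (v : 'I_N -> quat R) (W : R) V :
  \sum_l w l = W -> \sum_l w l *: v l = W *: V ->
  \sum_l w l * qnormsq (v l - V) = \sum_l w l * qnormsq (v l) - W * qnormsq V.
Proof.
move=> hW hV.
have comp (f : {additive quat R -> R}) : (forall c q, f (c *: q) = c * f q) ->
  \sum_l w l * f (v l - V) ^+ 2 = \sum_l w l * f (v l) ^+ 2 - W * f V ^+ 2.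
  move=> fZ.
  have h : \sum_l w l * f (v l) = W * f V.
    by rewrite -fZ -hV raddf_sum; apply: eq_bigr => l _; rewrite fZ.
  transitivity (\sum_l w l * f (v l) ^+ 2 - 2 * f V * \sum_l w l * f (v l)
     + f V ^+ 2 * \sum_l w l).
    rewrite !mulr_sumr -sumrB -big_split /=; apply: eq_bigr => l _.
    by rewrite raddfB; ring.
  by rewrite h hW; ring.
under eq_bigr do rewrite /qnormsq !mulrDr.
rewrite !big_split /= (comp (@qre R)) // (comp (@qi R)) // (comp (@qj R)) //.
rewrite (comp (@qk R)) //.
under [X in _ = X - _]eq_bigr do rewrite /qnormsq !mulrDr.
rewrite !big_split /= /qnormsq; ring.
Qed.

Lemma weighted_mean_le {N} (w : 'I_N -> R) (v : 'I_N -> quat R) (W : R) V (M : R) :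
  (forall l, 0 <= w l) -> 0 < W ->
  \sum_l w l = W -> \sum_l w l *: v l = W *: V ->
  (forall l, qnormsq (v l) <= M) ->
  qnormsq V <= M.
Proof.
move=> w0 W0 hW hV hM.
have h0 : 0 <= \sum_l w l * qnormsq (v l - V).
  by apply: sumr_ge0 => l _; rewrite mulr_ge0 ?qnormsq_ge0.
rewrite (weighted_variance hW hV) subr_ge0 in h0.
rewrite -(ler_pM2l W0) (le_trans h0) // -hW mulr_suml.
by apply: ler_sum => l _; rewrite ler_wpM2l.
Qed.

(** The variance is at most 0, so each of its nonnegative terms vanishes; a positive weight at [l]
    then forces [v l = V]. *)
Lemma weighted_mean_eq {N} (w : 'I_N -> R) (v : 'I_N -> quat R) (W : R) V l :
  (forall l, 0 <= w l) ->
  \sum_l w l = W -> \sum_l w l *: v l = W *: V ->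
  (forall l, qnormsq (v l) <= qnormsq V) -> 0 < w l ->
  v l = V.
Proof.
move=> w0 hW hV hM wl.
have t0 i : 0 <= w i * qnormsq (v i - V) by rewrite mulr_ge0 ?qnormsq_ge0.
have : \sum_l w l * qnormsq (v l - V) = 0.
  apply/eqP; rewrite eq_le sumr_ge0 ?andbT //.
  rewrite (weighted_variance hW hV) subr_le0 -hW mulr_suml.
  by apply: ler_sum => i _; rewrite ler_wpM2l.
move/eqP; rewrite psumr_eq0 // => /allP /(_ l).
rewrite mem_index_enum => /(_ isT) /=.
by rewrite mulf_eq0 gt_eqF //= qnormsq_eq0 subr_eq0 => /eqP.
Qed.

(** * Roots of unity in the quaternions *)

(** Geometric sum: multiplied by [z ^+ e - 1] it telescopes to 0, and there are no zero divisors. *)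
Lemma sum_prim_root {N z} e : N.-primitive_root z ->
  \sum_(l < N) z ^+ (l * e) = if (N %| e)%N then N%:R else 0.
Proof.
move=> hz; have [] := ifP; rewrite (prim_order_dvd hz) => ze.
  under eq_bigr do rewrite mulnC exprM (eqP ze) expr1n.
  by rewrite sumr_const card_ord.
have : (z ^+ e - 1) * (\sum_(l < N) z ^+ (l * e)) = 0.
  under eq_bigr do rewrite mulnC exprM.
  by rewrite -subrX1 -exprM mulnC exprM (prim_expr_order hz) expr1n subrr.
by move/eqP; rewrite qmul_eq0 subr_eq0 ze /= => /eqP.
Qed.

Lemma natr_quat_eq0 n : ((n%:R : quat R) == 0) = (n == 0).
Proof.
by rewrite -scaler_nat -qnormsq_eq0 qnormsqZ qnormsq1 mulr1 sqrf_eq0 pnatr_eq0.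
Qed.

Lemma prim_root_qnormsq {N z} : N.-primitive_root z -> qnormsq z = 1.
Proof.
move=> hz; apply/eqP; rewrite -(@pexpr_eq1 _ _ N) ?qnormsq_ge0 //.
  by rewrite -qnormsqX (prim_expr_order hz) qnormsq1.
exact: prim_order_gt0 hz.
Qed.

(** On the unit sphere the conjugate is the inverse; written as a power of [z], it keeps all
    exponents in [nat]. *)
Lemma qconj_prim_root {N z} : N.-primitive_root z -> qconj z = z ^+ N.-1.
Proof.
move=> hz; have N0 := prim_order_gt0 hz.
apply: (@qmul_inj z).
  by rewrite -qnormsq_eq0 (prim_root_qnormsq hz) oner_eq0.
by rewrite mul_qconj (prim_root_qnormsq hz) -exprS prednK // (prim_expr_order hz) scale1r.
Qed.

End Algebra.

(** * Roots of unity in the slice of a given quaternion *)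

Section Bernstein.
Local Set Implicit Arguments. Local Unset Strict Implicit.
Variable R : realType.
Implicit Types (p q u v x y z : quat R) (a : nat -> quat R) (c : R).

Lemma exists_commuting_imaginary_unit u :
  exists I : quat R, [/\ I * I = -1, qre I = 0 & GRing.comm u I].
Proof.
set s := qi u ^+ 2 + qj u ^+ 2 + qk u ^+ 2.
have s0 : 0 <= s by rewrite !addr_ge0 ?sqr_ge0.
have [/eqP s_eq0|s_neq0] := eqVneq s 0.
  (* Here [u] is real, hence central, and [i] serves as well as any imaginary unit. *)
  exists (Quat 0 1 0 0); split=> //; first by apply: quat_eq => /=; ring.
  have : qnormsq (u - (qre u)%:A) == 0.
    by rewrite -(eqP s_eq0); apply/eqP; rewrite /qnormsq /s /=; ring.
  rewrite qnormsq_eq0 subr_eq0 => /eqP ->.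
  by apply: quat_eq => /=; ring.
(* Otherwise the normalised vector part of [u] is taken. *)
exists ((Num.sqrt s)^-1 *: Quat 0 (qi u) (qj u) (qk u)); split.
- rewrite -scalerAl -scalerAr scalerA -expr2 exprVn sqr_sqrtr //.
  apply: (can_inj (scalerK s_neq0)); rewrite scalerA divff // scale1r.
  by apply: quat_eq; rewrite /s /=; ring.
- by rewrite /= mulr0.
- rewrite /GRing.comm -scalerAl -scalerAr; congr (_ *: _).
  by apply: quat_eq => /=; ring.
Qed.

(** The circle [cos x + I sin x] lies in the slice of [u], and multiplication on it adds angles; the
    root is its point of angle [2 pi / N]. *)
Lemma exists_commuting_prim_root u N : (0 < N)%N ->
  exists2 z, N.-primitive_root z & GRing.comm u z.
Proof.
move=> N0; have [I [II I0 uI]] := exists_commuting_imaginary_unit u.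
pose e (x : R) : quat R := (cos x)%:A + sin x *: I.
have eD (x y : R) : e x * e y = e (x + y).
  rewrite /e cosD sinD mulrDl !mulrDr -!scalerAl -!scalerAr !scalerA.
  rewrite !mul1r mulr1 II scalerN scalerBl scalerDl.
  rewrite (mulrC (cos x) (sin y)) (addrC (_ *: I) (- _)) !addrA.
  rewrite (addrAC _ (_ *: I) (- _)) -!addrA; congr (_ + (_ + _)).
  by rewrite addrC (mulrC (sin y)).
have eX (x : R) k : e x ^+ k = e (k%:R * x).
  elim: k => [|k IH]; first by rewrite mul0r /e cos0 sin0 scale0r addr0 scale1r.
  by rewrite exprS IH eD -natr1 mulrDl mul1r addrC.
have N0' : (0 : R) < N%:R by rewrite ltr0n.
exists (e (2 * pi / N%:R)); last first.
  by apply: commrD; rewrite /GRing.comm -!(scalerAl, scalerAr) ?mulr1 ?mul1r ?uI.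
apply/andP; split=> //; apply/forallP => i; apply/eqP; rewrite unity_rootE eX.
have [->|iN] := eqVneq i.+1 N.
  rewrite mulrC divfK ?gt_eqF // /e mulrC mulr_natr cos2pi sin2pi.
  by rewrite scale0r addr0 scale1r eqxx.
(* Real parts give [cos (2y) = 1], that is [sin y = 0], although [0 < y < pi]. *)
apply/negP => /eqP /(congr1 (@qre R)) /=; rewrite I0 mulr0 addr0 mulr1.
pose y : R := pi * (i.+1%:R / N%:R).
have -> : i.+1%:R * (2 * pi / N%:R) = y *+ 2 by rewrite /y; field; rewrite gt_eqF.
rewrite cos_mulr2n cos2sin2 => h.
have : 0 < sin y.
  apply: sin_gt0_pi; rewrite /y mulr_gt0 ?pi_gt0 ?divr_gt0 ?ltr0n //=.
  rewrite gtr_pMr ?pi_gt0 // ltr_pdivrMr // mul1r ltr_nat ltn_neqAle iN.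
  exact: ltn_ord.
by move=> s0; have := exprn_gt0 2 s0; lra.
Qed.

(** * Discrete Fourier sums and the Fejer kernel *)

Section RootsOfUnity.
Variables (N : nat) (z u : quat R).
Hypotheses (prim_z : N.-primitive_root z) (comm_uz : GRing.comm u z).

(** As [u] and [z] commute, the powers of [u * z ^+ l] split and the [a i] stay on the right: only
    Fourier coefficients of the weight [w] remain to be computed. *)
Lemma sum_twisted_spoly (w : 'I_N -> R) a n e :
  \sum_(l < N) w l *: (z ^+ (l * e) * spoly a n (u * z ^+ l)) =
  \sum_(i < n.+1) u ^+ i * (\sum_(l < N) w l *: z ^+ (l * (e + i))) * a i.
Proof.
under eq_bigr do rewrite spolyE mulr_sumr scaler_sumr.
rewrite exchange_big /=; apply: eq_bigr => i _.
rewrite mulr_sumr mulr_suml; apply: eq_bigr => l _.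
rewrite exprMn_comm; last exact: commrX.
rewrite -scalerAr -scalerAl; congr (_ *: _).
rewrite !mulrA mulnDr exprD !mulrA -exprM; congr (_ * _ * _).
by apply/commr_sym/commrX/commr_sym/commrX/commr_sym.
Qed.

(** Fourier inversion; [N - j] stands for the frequency [-j]. Since [n < N], no other index up to
    [n] is congruent to [j] modulo [N]. *)
Lemma spoly_fourier_coef a n j : (n < N)%N -> (j <= n)%N ->
  \sum_(l < N) z ^+ (l * (N - j)) * spoly a n (u * z ^+ l) =
  N%:R *: (u ^+ j * a j).
Proof.
move=> nN jn.
transitivity (\sum_(l < N) 1 *: (z ^+ (l * (N - j)) * spoly a n (u * z ^+ l))).
  by apply: eq_bigr => l _; rewrite scale1r.
rewrite (sum_twisted_spoly (fun=> 1)).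
have jn' : (j < n.+1)%N by [].
rewrite (bigD1 (Ordinal jn')) //= [X in _ + X]big1 ?addr0 => [|i].
  under eq_bigr do rewrite scale1r.
  rewrite (sum_prim_root _ prim_z) ifT; last by rewrite subnK //; lia.
  by rewrite mulr_natr -scaler_nat -scalerAl.
rewrite -val_eqE /= => ij; under eq_bigr do rewrite scale1r.
rewrite (sum_prim_root _ prim_z) ifF ?mulr0 ?mul0r //.
apply/negbTE/negP => /dvdnP [[|[|k]]]; have := ltn_ord i; first lia.
  by move=> *; move/eqP: ij; lia.
nia.
Qed.

(* The Fejer kernel of order [n] at [z ^+ l]: its Fourier coefficient at
   frequency [n - j] is proportional to [j], the factor by which
   [q * P'(q)] multiplies the [j]-th term of [P]. *)
Definition fejer n (l : 'I_N) : R := qnormsq (\sum_(p < n) z ^+ (l * p)).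

Lemma fejer_ge0 n l : 0 <= fejer n l.
Proof. exact: qnormsq_ge0. Qed.

(** A vanishing geometric sum gives [z ^+ (l * n) = 1], so [N] divides [l] by coprimality and
    [l = 0]; but there the sum is [n]. *)
Lemma fejer_gt0 n l : (0 < n)%N -> coprime N n -> 0 < fejer n l.
Proof.
move=> n0 Nn; rewrite lt_neqAle fejer_ge0 eq_sym qnormsq_eq0 andbT.
under eq_bigr do rewrite exprM.
apply/eqP => h; have := subrX1 (z ^+ l) n; rewrite h mulr0 -exprM => /eqP.
rewrite subr_eq0 -(prim_order_dvd prim_z) Gauss_dvdl // => Nl.
have l0 : l = 0%N :> nat.
  by apply/eqP; rewrite -leqn0 leqNgt; apply/negP => /dvdn_leq /(_ Nl); have := ltn_ord l; lia.
move/eqP: h; under eq_bigr do rewrite l0 expr0 expr1n.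
by rewrite sumr_const card_ord natr_quat_eq0 => /eqP; lia.
Qed.

(** The exponent stands for the frequency [j - n]. Expanding the square, the sum over [l] keeps the
    pairs with [p + j = p' + n], of which there are [j]. *)
Lemma fejer_fourier_coef n j : N = n.*2.+1 -> (j <= n)%N ->
  \sum_(l < N) fejer n l *: z ^+ (l * (N - n + j)) = (N * j)%:R.
Proof.
move=> hN jn.
have E (l : 'I_N) : fejer n l *: z ^+ (l * (N - n + j)) =
    \sum_(p < n) \sum_(p' < n) z ^+ (l * (p + N.-1 * p' + (N - n + j))).
  rewrite -[X in _ *: X]mul1r scalerAl -mul_qconj raddf_sum /= mulr_suml mulr_suml.
  apply: eq_bigr => p _; rewrite mulr_sumr mulr_suml; apply: eq_bigr => p' _.
  rewrite qconjX (qconj_prim_root prim_z) -exprM -!exprD; congr (_ ^+ _).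
  by rewrite !mulnDr mulnCA.
under eq_bigr do rewrite E.
rewrite exchange_big /=.
under eq_bigr do rewrite exchange_big /=.
have F (p p' : 'I_n) : \sum_(l < N) z ^+ (l * (p + N.-1 * p' + (N - n + j))) =
   (if (p + j == p' + n)%N then N else 0)%:R.
  rewrite (sum_prim_root _ prim_z).
  have -> : (N %| p + N.-1 * p' + (N - n + j))%N = (p + j == p' + n)%N.
    (* The second summand lies strictly between 0 and [2N], so [N] divides it only if it equals
       [N]. *)
    have -> : (p + N.-1 * p' + (N - n + j) = p' * N + (p + j + N - (p' + n)))%N.
      by have := ltn_ord p'; rewrite hN /= ; nia.
    rewrite dvdn_addr ?dvdn_mull //.
    apply/idP/eqP => [/dvdnP [[|[|k]]]|->]; last by rewrite addnC addnK.
    - by have := ltn_ord p'; lia.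
    - by have := ltn_ord p'; lia.
    - by have := ltn_ord p; nia.
  by case: ifP.
under eq_bigr do under eq_bigr do rewrite F.
under eq_bigr do rewrite -natr_sum.
rewrite -natr_sum; congr (_ %:R).
(* For given [p] the only candidate is [p' = p + j - n], available when [n - j <= p]. *)
transitivity (\sum_(p < n) if (n - j <= p)%N then N else 0)%N.
  apply: eq_bigr => p _; rewrite -big_mkcond /=.
  case: leqP => h.
    have hp : (p + j - n < n)%N by have := ltn_ord p; lia.
    rewrite (big_pred1 (Ordinal hp)) // => p' /=; rewrite -val_eqE /=.
    by apply/eqP/eqP; lia.
  by rewrite big_pred0 // => p'; apply/eqP; lia.
rewrite -big_mkcond /= -(big_mkord (fun k => (n - j <= k)%N) (fun=> N)).
rewrite (@big_cat_nat _ _ _ (n - j)%N) ?leq_subr //=.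
rewrite big_nat_cond big_pred0 ?add0n; last by move=> i; lia.
rewrite big_nat_cond (eq_bigl (fun i => (n - j <= i < n)%N)); last by move=> i; lia.
by rewrite -big_nat sum_nat_const_nat subKn // mulnC.
Qed.

Lemma sum_fejer n : N = n.*2.+1 -> \sum_(l < N) fejer n l = (N * n)%:R.
Proof.
move=> hN; have := fejer_fourier_coef hN (leqnn n).
rewrite subnK; last by lia.
under eq_bigr do rewrite mulnC exprM (prim_expr_order prim_z) expr1n.
rewrite -scaler_suml -scaler_nat => /(congr1 (@qre R)) /=.
by rewrite !mulr1.
Qed.

(** The kernel multiplies the [i]-th term by [N * i], producing [u P'(u)]. The right-hand side is
    shaped as total weight times mean. *)
Lemma fejer_sum_spoly a n : N = n.+1.*2.+1 ->
  \sum_(l < N) fejer n.+1 l *: (z ^+ (l * (N - n.+1)) * spoly a n.+1 (u * z ^+ l))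
  = (N * n.+1)%:R *: (n.+1%:R^-1 *: (u * spoly_deriv a n.+1 u)).
Proof.
move=> hN; rewrite sum_twisted_spoly spoly_derivE spolyE.
transitivity (\sum_(i < n.+2) (N * i)%:R *: (u ^+ i * a i)).
  apply: eq_bigr => i _; rewrite fejer_fourier_coef //; last by rewrite -ltnS.
  by rewrite mulr_natr -scaler_nat -scalerAl.
rewrite big_ord_recl muln0 scale0r add0r scalerA natrM mulfK ?pnatr_eq0 //.
rewrite mulr_sumr scaler_sumr; apply: eq_bigr => i _.
by rewrite lift0 natrM -scalerA mulrA -exprS -scalerAr.
Qed.

End RootsOfUnity.

(** * Bernstein inequality at a point of the unit sphere *)

Lemma bernstein_sphere a n u (M : R) : qnormsq u = 1 ->
  (forall q, qnormsq q <= 1 -> qnormsq (spoly a n.+1 q) <= M) ->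
  qnormsq (spoly_deriv a n.+1 u) <= n.+1%:R ^+ 2 * M /\
  (qnormsq (spoly_deriv a n.+1 u) = n.+1%:R ^+ 2 * M ->
   forall j, (j < n.+1)%N -> a j = 0).
Proof.
move=> u1 hM; pose N := n.+1.*2.+1.
have [z hz uz] := @exists_commuting_prim_root u N isT.
have Nz k : qnormsq (z ^+ k) = 1 by rewrite qnormsqX (prim_root_qnormsq hz) expr1n.
have sw := sum_fejer hz (erefl N).
have sv := fejer_sum_spoly hz uz a (erefl N).
set v := (fun l : 'I_N => z ^+ (l * (N - n.+1)) * spoly a n.+1 (u * z ^+ l)).
set V := _^-1 *: _ in sv.
have hv l : qnormsq (v l) <= M.
  by rewrite qnormsqM Nz mul1r hM // qnormsqM u1 Nz mulr1.
have n0 : n.+1%:R != 0 :> R by rewrite pnatr_eq0.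
have NV : qnormsq (spoly_deriv a n.+1 u) = n.+1%:R ^+ 2 * qnormsq V.
  by rewrite /V qnormsqZ qnormsqM u1 mul1r mulrA -exprMn divff // expr1n mul1r.
have W0 : 0 < (N * n.+1)%:R :> R by rewrite ltr0n.
split.
  rewrite NV ler_pM2l ?exprn_gt0 ?ltr0n //.
  apply: (weighted_mean_le _ _ sw sv hv) => // l; exact: fejer_ge0.
rewrite NV => /mulfI VM j jn.
have {}VM : qnormsq V = M by apply: VM; rewrite expf_neq0.
(* Equality makes the mean as large as the bound on the values; all weights are positive because
   [2m + 1] and [m] are coprime. *)
have vV l : v l = V.
  apply: (weighted_mean_eq _ sw sv); rewrite ?VM //.
    by move=> i; exact: fejer_ge0.
  apply: fejer_gt0 => //; rewrite /N -addnn -addSn coprime_sym /coprime.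
  by rewrite gcdnDr -/(coprime _ _) coprimenS.
have jn1 : (j <= n.+1)%N by apply: ltnW.
have nN : (n.+1 < N)%N by rewrite /N; lia.
have := spoly_fourier_coef hz uz a nN jn1.
(* Hence [P(u z^l) = z^(lm) V] with [m = n + 1]. Its Fourier sum at [j < m] vanishes, as [m + N - j]
   lies strictly between [N] and [2N]. *)
have E (l : 'I_N) : z ^+ (l * (N - j)) * spoly a n.+1 (u * z ^+ l) =
    z ^+ (l * (n.+1 + (N - j))) * V.
  rewrite -(vV l) /v mulrA -exprD.
  have -> : (l * (n.+1 + (N - j)) + l * (N - n.+1) = l * (N - j) + N * l)%N.
    by rewrite /N; nia.
  by rewrite exprD [z ^+ (N * l)]exprM (prim_expr_order hz) expr1n mulr1.
under eq_bigr do rewrite E.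
rewrite -mulr_suml (sum_prim_root _ hz) ifF; last first.
  by apply/negbTE/negP => /dvdnP [[|[|k]]]; rewrite /N; nia.
rewrite mul0r => /esym/eqP; rewrite scaler_eq0 pnatr_eq0 /= qmul_eq0.
by rewrite -qnormsq_eq0 qnormsqX u1 expr1n oner_eq0 /= => /eqP.
Qed.

End Bernstein.

(** * Maximum modulus principle *)

Section MaximumModulus.
Local Set Implicit Arguments. Local Unset Strict Implicit.
Variable R : realType.
Implicit Types (p q u v : quat R) (a : nat -> quat R) (c : R).

Lemma qnorm0 : qnorm (0 : quat R) = 0.
Proof. by rewrite /qnorm /= expr0n /= !addr0 sqrtr0. Qed.

Lemma quat_polar q : exists u, qnormsq u = 1 /\ q = qnorm q *: u.
Proof.
have [->|q0] := eqVneq q 0.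
  exists 1; rewrite qnormsq1; split=> //.
  by rewrite qnorm0 scale0r.
have n0 : qnorm q != 0.
  by rewrite qnormE sqrtr_eq0 -ltNge lt_neqAle qnormsq_ge0 andbT eq_sym qnormsq_eq0.
exists ((qnorm q)^-1 *: q); rewrite scalerA divff // scale1r; split=> //.
by rewrite qnormsqZ exprVn {1}qnormE sqr_sqrtr ?qnormsq_ge0 // mulVf // qnormsq_eq0.
Qed.

(** Mean value property of a monomial on a regular [N]-gon: in the binomial expansion every power
    [z ^+ (l * k)] with [0 < k < N] sums to 0. *)
Lemma sum_prim_root_shift N (z : quat R) (r s : R) i : N.-primitive_root z -> (i < N)%N ->
  \sum_(l < N) (r%:A + s *: z ^+ l) ^+ i = (N%:R * r ^+ i)%:A.
Proof.
move=> hz iN.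
have cm (l : 'I_N) : GRing.comm (r%:A : quat R) (s *: z ^+ l).
  by rewrite /GRing.comm -!(scalerAl, scalerAr) mulr1 mul1r scalerA mulrC -scalerA.
under eq_bigr do rewrite exprDn_comm //.
rewrite exchange_big /= big_ord_recl /= [X in _ + X]big1 ?addr0 => [|k _].
  under eq_bigr do rewrite subn0 expr0 mulr1 bin0 mulr1n exprZn expr1n.
  by rewrite sumr_const card_ord mulr_natl scalerMnl.
under eq_bigr do rewrite /bump leq0n add1n 2!exprZn expr1n -scalerAl mul1r
    -exprM scalerA -scaler_nat scalerA.
rewrite -scaler_sumr (sum_prim_root _ hz) ifF ?scaler0 //.
by apply/negbTE/negP => /dvdn_leq; have := ltn_ord k; lia.
Qed.

(* [P(q)] is the mean of [P] over the vertices of a regular polygon, centred at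
   [q] and lying in the slice of [q], one of which is on the unit sphere; at a
   maximum of [|P|] all those values coincide with [P(q)]. *)
Lemma max_modulus_sphere a n q : qnorm q <= 1 ->
  (forall p, qnorm p <= 1 -> qnormsq (spoly a n p) <= qnormsq (spoly a n q)) ->
  exists2 u, qnormsq u = 1 & spoly a n u = spoly a n q.
Proof.
move=> q1 hmax; have [u [u1 qE]] := quat_polar q.
have r0 : 0 <= qnorm q by rewrite sqrtr_ge0.
exists u => //; move: r0 q1 qE; set r := qnorm q => r0 r1 qE.
have [z hz uz] := @exists_commuting_prim_root _ u n.+1 isT.
(* The polygon has centre [r u = q] and radius [1 - r]; its vertex [l = 0] is [u]. *)
pose v (l : 'I_n.+1) := spoly a n (u * (r%:A + (1 - r) *: z ^+ l)).
have -> : spoly a n u = v ord0.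
  by rewrite /v expr0 -scalerDl addrC subrK scale1r mulr1.
apply: (@weighted_mean_eq _ _ (fun=> 1) v n.+1%:R) => //.
- by rewrite sumr_const card_ord.
- rewrite /v; under eq_bigr do rewrite scale1r spolyE.
  rewrite exchange_big spolyE scaler_sumr /=; apply: eq_bigr => i _.
  transitivity (u ^+ i * (\sum_(l < n.+1) (r%:A + (1 - r) *: z ^+ l) ^+ i) * a i).
    rewrite mulr_sumr mulr_suml; apply: eq_bigr => l _.
    rewrite exprMn_comm //; apply: commrD.
      by rewrite /GRing.comm -!(scalerAl, scalerAr) mulr1 mul1r.
    by rewrite /GRing.comm -scalerAl -scalerAr; congr (_ *: _); apply: commrX.
  rewrite (sum_prim_root_shift _ _ hz) // -scalerAr mulr1 qE exprZn.
  by rewrite -!scalerAl scalerA.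
- move=> l; apply: hmax; rewrite qnorm_le1 qnormsqM u1 mul1r.
  have := prim_root_qnormsq hz => /(congr1 (fun x => x ^+ l)).
  rewrite -qnormsqX expr1n; set w := z ^+ l; rewrite /qnormsq /= => hw.
  have re1 : qre w <= 1.
    have := (sqr_ge0 (qi w), sqr_ge0 (qj w), sqr_ge0 (qk w)) => -[[? ?] ?].
    by have := sqr_ge0 (qre w - 1); nra.
  (* The squared modulus [r^2 + 2r(1-r) Re w + (1-r)^2] is at most [(r + (1-r))^2 = 1]. *)
  have rs : 0 <= r * (1 - r) by rewrite mulr_ge0 ?subr_ge0.
  have h : r * (1 - r) * qre w <= r * (1 - r) by rewrite ler_piMr.
  rewrite !mulr0 !mulr1 !add0r.
  have -> : (r + (1 - r) * qre w) ^+ 2 + ((1 - r) * qi w) ^+ 2 +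
    ((1 - r) * qj w) ^+ 2 + ((1 - r) * qk w) ^+ 2 =
    r ^+ 2 + 2 * (r * (1 - r) * qre w) +
    (1 - r) ^+ 2 * (qre w ^+ 2 + qi w ^+ 2 + qj w ^+ 2 + qk w ^+ 2) by ring.
  rewrite hw; nra.
Qed.

(** * Continuity and existence of the maximum *)

(** Coordinatewise, so that no topology on [quat] has to be set up. *)
Definition qcontinuous {T : topologicalType} (F : T -> quat R) :=
  [/\ continuous (fun t => qre (F t)), continuous (fun t => qi (F t)),
      continuous (fun t => qj (F t)) & continuous (fun t => qk (F t))].

Section QContinuous.
Context {T : topologicalType}.
Implicit Types F G : T -> quat R.

Lemma qcontinuous_cst q : qcontinuous (fun _ : T => q).
Proof. by split=> t; apply: cst_continuous. Qed.

Lemma qcontinuousD F G : qcontinuous F -> qcontinuous G ->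
  qcontinuous (fun t => qadd (F t) (G t)).
Proof.
move=> [a1 a2 a3 a4] [b1 b2 b3 b4].
by split=> t; [exact: cvgD (a1 t) (b1 t) | exact: cvgD (a2 t) (b2 t)
  | exact: cvgD (a3 t) (b3 t) | exact: cvgD (a4 t) (b4 t)].
Qed.

Lemma qcontinuousM F G : qcontinuous F -> qcontinuous G ->
  qcontinuous (fun t => qmul (F t) (G t)).
Proof.
move=> [a1 a2 a3 a4] [b1 b2 b3 b4].
by split=> t /=; repeat first [apply: a1 | apply: a2 | apply: a3 | apply: a4
  | apply: b1 | apply: b2 | apply: b3 | apply: b4
  | apply: cvgB | apply: cvgD | apply: cvgM].

Qed.

Lemma qcontinuous_spoly a n F : qcontinuous F ->
  qcontinuous (fun t => spoly a n (F t)).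
Proof.
move=> cF; rewrite /spoly.
have cX k : qcontinuous (fun t => qpow (F t) k).
  by elim: k => [|k IH] /=; [exact: qcontinuous_cst | exact: qcontinuousM].
elim: n => [|n IH] /=; first by apply: qcontinuousM => //; exact: qcontinuous_cst.
apply: qcontinuousD => //; apply: qcontinuousM; last exact: qcontinuous_cst.
exact: (cX n.+1).
Qed.

Lemma continuous_qnormsq F : qcontinuous F -> continuous (fun t => qnormsq (F t)).
Proof.
move=> [c1 c2 c3 c4] t.
rewrite /qnormsq; repeat apply: cvgD; apply: cvgM;
  solve [exact: c1 | exact: c2 | exact: c3 | exact: c4].
Qed.

End QContinuous.

Lemma qcontinuous_quat_of_tuple : qcontinuous (@quat_of_tuple R).
Proof.
have c1 : continuous (fun t : R * R * R * R => t.1) by move=> t; apply: cvg_fst.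
have c2 : continuous (fun t : R * R * R => t.1) by move=> t; apply: cvg_fst.
have c3 : continuous (fun t : R * R => t.1) by move=> t; apply: cvg_fst.
have c12 : continuous (fun t : R * R * R * R => t.1.1).
  by move=> t; apply: (@continuous_comp _ _ _ fst fst); [exact: c1|exact: c2].
split.
- have -> : (fun t => qre (@quat_of_tuple R t)) = (fun t => t.1.1.1).
    by apply/funext => -[[[? ?] ?] ?].
  move=> t; apply: (@continuous_comp _ _ _ (fun t : R * R * R * R => t.1.1) fst).
    exact: c12.
  exact: c3.
- have -> : (fun t => qi (@quat_of_tuple R t)) = (fun t => t.1.1.2).
    by apply/funext => -[[[? ?] ?] ?].
  move=> t; apply: (@continuous_comp _ _ _ (fun t : R * R * R * R => t.1.1) snd).
    exact: c12.
  exact: cvg_snd.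
- have -> : (fun t => qj (@quat_of_tuple R t)) = (fun t => t.1.2).
    by apply/funext => -[[[? ?] ?] ?].
  move=> t; apply: (@continuous_comp _ _ _ fst snd); first exact: c1.
  exact: cvg_snd.
- have -> : (fun t => qk (@quat_of_tuple R t)) = (fun t => t.2).
    by apply/funext => -[[[? ?] ?] ?].
  move=> t; exact: cvg_snd.
Qed.

(** In [R^4] the unit ball is closed in the compact cube [[-1, 1]^4], and the extreme value theorem
    applies. *)
Lemma spoly_max_attained a n : exists2 q, qnorm q <= 1 &
  forall p, qnorm p <= 1 -> qnormsq (spoly a n p) <= qnormsq (spoly a n q).
Proof.
pose A : set (R * R * R * R) := [set t | qnormsq (quat_of_tuple t) <= 1]%classic.
pose I : set R := `[-1, 1]%classic.
have cI : compact I by exact: segment_compact.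
have A0 : (A !=set0)%classic.
  by exists (0, 0, 0, 0); rewrite /A /qnormsq /= expr0n /= !addr0 ler01.
have cA : compact A.
  apply: (@subclosed_compact _ _ (I `*` I `*` I `*` I)%classic).
  - rewrite (_ : A = (fun t => qnormsq (@quat_of_tuple R t)) @^-1` [set x | x <= 1])%classic //.
    apply: closed_comp; last exact: closed_le.
    by move=> t _; apply: continuous_qnormsq; exact: qcontinuous_quat_of_tuple.
  - by do 3 apply: compact_setX => //.
  - have le1 (x y : R) : 0 <= y -> x ^+ 2 + y <= 1 -> x \in `[-1, 1].
      by move=> y0 h; rewrite in_itv /=; apply/andP; split; nra.
    move=> [[[x y] z] w]; rewrite /A /I /qnormsq /= => h.
    have := (sqr_ge0 x, sqr_ge0 y, sqr_ge0 z, sqr_ge0 w) => -[[[? ?] ?] ?].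
    do ![split => /=].
    + by apply: (le1 _ (y ^+ 2 + z ^+ 2 + w ^+ 2)); lra.
    + by apply: (le1 _ (x ^+ 2 + z ^+ 2 + w ^+ 2)); lra.
    + by apply: (le1 _ (x ^+ 2 + y ^+ 2 + w ^+ 2)); lra.
    + by apply: (le1 _ (x ^+ 2 + y ^+ 2 + z ^+ 2)); lra.
have cF : continuous (fun t => qnormsq (spoly a n (@quat_of_tuple R t))).
  by apply/continuous_qnormsq/qcontinuous_spoly; exact: qcontinuous_quat_of_tuple.
have [t tA ht] := compact_EVT_max A0 cA (continuous_subspaceT cF).
exists (quat_of_tuple t); first by rewrite qnorm_le1; move: tA; rewrite inE.
move=> p p1; rewrite -(tuple_of_quatK p); apply: ht.
by rewrite inE /A /mkset tuple_of_quatK -qnorm_le1.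
Qed.

(** * Supremum norm and uniqueness of coefficients *)

Lemma supnorm_eq (F : quat R -> quat R) q : qnorm q <= 1 ->
  (forall p, qnorm p <= 1 -> qnorm (F p) <= qnorm (F q)) ->
  supnorm F = qnorm (F q).
Proof.
move=> q1 hq; rewrite /supnorm; set E := [set _ | _ in _]%classic.
have Eq : E (qnorm (F q)) by exists q.
have Eub : ubound E (qnorm (F q)) by move=> _ [p p1 <-]; exact: hq.
apply/eqP; rewrite eq_le; apply/andP; split.
  by apply: ge_sup => //; exists (qnorm (F q)).
by apply: ub_le_sup => //; exists (qnorm (F q)).
Qed.

Lemma qnormM p q : qnorm (p * q) = qnorm p * qnorm q.
Proof. by rewrite !qnormE qnormsqM sqrtrM ?qnormsq_ge0. Qed.

Lemma supnorm_monomial k q : supnorm (fun p => qmul (qpow p k) q) = qnorm q.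
Proof.
have n1 : qnorm (1 : quat R) = 1 by rewrite qnormE qnormsq1 sqrtr1.
have E p : qnorm (qmul (qpow p k) q) = qnorm p ^+ k * qnorm q.
  have -> : qmul (qpow p k) q = p ^+ k * q by rewrite qpowE.
  rewrite qnormM; congr (_ * _).
  by elim: k => [|k IH]; rewrite ?expr0 // !exprS qnormM IH.
rewrite (@supnorm_eq _ 1) ?E ?n1 ?expr1n ?mul1r // => p p1.
by rewrite E ler_piMl ?sqrtr_ge0 // exprn_ile1 ?sqrtr_ge0.
Qed.

Lemma spoly_max_supnorm a n : exists2 q, qnorm q <= 1 &
  supnorm (spoly a n) = qnorm (spoly a n q) /\
  forall p, qnorm p <= 1 -> qnormsq (spoly a n p) <= qnormsq (spoly a n q).
Proof.
have [q q1 hq] := spoly_max_attained a n; exists q => //; split=> //.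
by apply: supnorm_eq => // p p1; rewrite !qnormE ler_sqrt ?qnormsq_ge0 ?hq.
Qed.

(** Fourier inversion with [u = 1] and [N = n + 1] recovers the coefficients from the values. *)
Lemma spoly_inj a b n : (forall q, spoly a n q = spoly b n q) ->
  forall j, (j <= n)%N -> a j = b j.
Proof.
move=> ab j jn; have [z hz _] := @exists_commuting_prim_root R 1 n.+1 isT.
have c1z : GRing.comm 1 z by exact/commr_sym/commr1.
have ha := spoly_fourier_coef hz c1z a (ltnSn n) jn.
have := spoly_fourier_coef hz c1z b (ltnSn n) jn.
under eq_bigr do rewrite -ab.
rewrite ha expr1n !mul1r; apply: scalerI; by rewrite pnatr_eq0.
Qed.

Lemma spoly_monomial a n q : (forall j, (j < n)%N -> a j = 0) ->
  spoly a n q = qmul (qpow q n) (a n).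
Proof.
move=> a0; rewrite spolyE big_ord_recr /= big1 ?add0r ?qpowE // => j _.
by rewrite a0 ?mulr0.
Qed.

Lemma spoly_eq_monomial a n b : (forall q, spoly a n q = qmul (qpow q n) b) ->
  forall j, (j < n)%N -> a j = 0.
Proof.
move=> h j jn; pose c k := if k == n then b else 0.
have -> : a j = c j.
  apply: (@spoly_inj a c n) (ltnW jn) => q.
  rewrite h (spoly_monomial q) /c ?eqxx // => k kn.
  by rewrite ltn_eqF.
by rewrite /c ltn_eqF.
Qed.

End MaximumModulus.

(** * Bernstein inequality for the supremum norm *)

Theorem theorem1p1 (R : realType) (n : nat) (a : nat -> quat R)
  (han : a n <> qzero R) :
  supnorm (spoly_deriv a n) <= n%:R * supnorm (spoly a n) /\
  (supnorm (spoly_deriv a n) = n%:R * supnorm (spoly a n) <->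
   exists an : quat R, forall q : quat R, spoly a n q = qmul (qpow q n) an).
Proof.
case: n han => [|n] han.
  (* In degree 0 both sides are 0 and [P] is its own leading term. *)
  have -> : supnorm (spoly_deriv a 0%N) = 0.
    have n0 : qnorm (0 : quat R) = 0 by exact: qnorm0.
    by rewrite (supnorm_eq (q := 0)) ?n0 ?ler01.
  by rewrite mul0r; split=> //; split=> // _; exists (a 0%N).
have [p p1 [pE hp]] := spoly_max_supnorm a n.+1.
rewrite spoly_derivE.
have [q q1 [qE hq]] := spoly_max_supnorm (fun i => i.+1%:R *: a i.+1) n.
(* The maximum of [|P'|] is moved to a point [u] of the sphere, where the pointwise inequality and
   its equality case apply. *)
have [u u1 uE] := max_modulus_sphere q1 hq.
have [le_bern eq_bern] := bernstein_sphere u1 (fun v (v1 : qnormsq v <= 1) =>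
  hp v (etrans (qnorm_le1 v) v1)).
rewrite spoly_derivE uE in le_bern eq_bern.
have nE : n.+1%:R * qnorm (spoly a n.+1 p) =
    Num.sqrt (n.+1%:R ^+ 2 * qnormsq (spoly a n.+1 p)).
  by rewrite sqrtrM ?sqr_ge0 // sqrtr_sqr ger0_norm.
split; first by rewrite pE qE nE qnormE ler_sqrt // mulr_ge0 ?sqr_ge0 ?qnormsq_ge0.
split=> [h|[b hb]].
  exists (a n.+1) => x; apply: spoly_monomial => j; apply: eq_bern.
  apply/eqP; rewrite -eqr_sqrt ?mulr_ge0 ?sqr_ge0 ?qnormsq_ge0 //.
  by rewrite -nE -pE -h qE qnormE.
(* Conversely both polynomials are monomials, whose norms are the moduli of their coefficients. *)
have a0 := spoly_eq_monomial hb.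
have -> : spoly a n.+1 = fun x => qmul (qpow x n.+1) (a n.+1).
  by apply/funext => x; exact: spoly_monomial.
have -> : spoly (fun i => i.+1%:R *: a i.+1) n =
    fun x => qmul (qpow x n) (n.+1%:R *: a n.+1).
  by apply/funext => x; rewrite spoly_monomial // => j jn; rewrite a0 ?scaler0.
rewrite !supnorm_monomial !qnormE qnormsqZ sqrtrM ?sqr_ge0 // sqrtr_sqr.
by rewrite ger0_norm.
Qed.
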